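(* Let $m\ge 2$ be an integer. The digraph $\mathcal{D}^*_m$ has exactly $\lfloor m/2\rfloor+1$ components, i.e. $\mathcal{D}^*_m=\mathcal{A}^*_m\cup\bigcup_{s=1}^{\lfloor m/2\rfloor}\mathcal{B}^{*(s)}_m$, where $\mathcal{A}^*_m$ denotes the component containing the word $1^m$, and $\mathcal{B}^{*(1)}_m,\ldots,\mathcal{B}^{*(\lfloor m/2\rfloor)}_m$ denote the remaining components, indexed so that $|V(\mathcal{B}^{*(1)}_m)|\ge |V(\mathcal{B}^{*(2)}_m)|\ge\cdots\ge |V(\mathcal{B}^{*(\lfloor m/2\rfloor)}_m)|$. Moreover: (i) All the components $\mathcal{B}^{*(s)}_m$, $1\le s\le\lfloor m/2\rfloor$, are bipartite digraphs. (ii) If $m$ is odd, then $|V(\mathcal{B}^{*(s)}_m)|=\binom{m+1}{(m+1)/2-s}$ for $1\le s\le\lfloor m/2\rfloor$, and $|V(\mathcal{A}^*_m)|=\binom{m}{(m-1)/2}$. (iii) If $m$ is even, then $|V(\mathcal{B}^{*(s)}_m)|=2\binom{m}{m/2-s}$ for $1\le s\le\lfloor m/2\rfloor$, and $|V(\mathcal{A}^*_m)|=\binom{m}{m/2}$. (iv) For every vertex $v$ of $\mathcal{D}^*_m$, the vertices $v$ and $\overline{v}$ belong to the same component. When this component is bipartite, $v$ and $\overline{v}$ are placed in the same class of the bipartition if and only if $m$ is odd.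
   Context: Code letters. Each letter of the alphabet $\{a,b,c,d,e,f\}$ encodes a 2-element subset of the four directions $\{\text{up},\text{down},\text{left},\text{right}\}$ (the two edges of a 2-factor used at a grid vertex): $a=\{\text{right},\text{down}\}$, $b=\{\text{up},\text{down}\}$, $c=\{\text{up},\text{right}\}$, $d=\{\text{left},\text{down}\}$, $e=\{\text{left},\text{right}\}$, $f=\{\text{up},\text{left}\}$. Digraph $\mathcal{D}_m$ ($m\ge1$). Its vertices (alpha-words) are the words $\alpha_1\alpha_2\cdots\alpha_m$ over $\{a,b,c,d,e,f\}$ (read as a column from top to bottom) such that: $\alpha_1\in\{a,d,e\}$ (does not contain up), $\alpha_m\in\{c,e,f\}$ (does not contain down), and for $1\le i\le m-1$, $\alpha_i$ contains down if and only if $\alpha_{i+1}$ contains up. There is an arc from $\alpha_1\cdots\alpha_m$ to $\beta_1\cdots\beta_m$ if and only if for every $i$, $\alpha_i$ contains right if and only if $\beta_i$ contains left. Outlet word. For an alpha-word $\alpha$, its outlet word $o(\alpha)=o_1\cdots o_m\in\{0,1\}^m$ has $o_j=1$ if $\alpha_j\in\{a,c,e\}$ (contains right) and $o_j=0$ if $\alpha_j\in\{b,d,f\}$. Digraph $\mathcal{D}^*_m$. It is obtained from $\mathcal{D}_m$ by gluing all vertices having the same outlet word: its vertices are the binary words $o(\alpha)$, $\alpha\in V(\mathcal{D}_m)$, and there is a (single) arc $v\to w$ if and only if there are $\alpha,\beta\in V(\mathcal{D}_m)$ with $o(\alpha)=v$, $o(\beta)=w$ and an arc from $\alpha$ to $\beta$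 in $\mathcal{D}_m$. Loops are allowed. The arc relation is known to be symmetric ($v\to w$ iff $w\to v$), so every component of $\mathcal{D}^*_m$ (connected component of the underlying graph) is strongly connected. It is also known that $V(\mathcal{D}^*_m)=\{0,1\}^m$ for $m$ even, and $V(\mathcal{D}^*_m)=\{0,1\}^m\setminus\{(01)^k0\}$ for $m=2k+1$. For a binary word $v=v_1v_2\cdots v_m$, $\overline{v}=v_m v_{m-1}\cdots v_1$ is the reversed word. A digraph is bipartite if its vertex set can be partitioned into two classes such that no arc joins two vertices (possibly equal) of the same class. *)

(* Defs.v *)
From HB Require Import structures.
From mathcomp Require Import all_boot.

Set Implicit Arguments.
Unset Strict Implicit.
Unset Printing Implicit Defensive.

Inductive direction := Up | Down | Left | Right.

Definition direction_code (x : direction) : 'I_4 :=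
  match x with
  | Up => inord 0 | Down => inord 1 | Left => inord 2 | Right => inord 3
  end.

Definition direction_decode (i : 'I_4) : direction :=
  match val i with 0 => Up | 1 => Down | 2 => Left | _ => Right end.

Lemma direction_codeK : cancel direction_code direction_decode.
Proof. by case; rewrite /direction_decode /= inordK. Qed.

HB.instance Definition _ := Finite.copy direction (can_type direction_codeK).

Inductive letter := La | Lb | Lc | Ld | Le | Lf.

Definition letter_code (x : letter) : 'I_6 :=
  match x with
  | La => inord 0 | Lb => inord 1 | Lc => inord 2
  | Ld => inord 3 | Le => inord 4 | Lf => inord 5
  end.

Definition letter_decode (i : 'I_6) : letter :=
  match val i with
  | 0 => La | 1 => Lb | 2 => Lc | 3 => Ld | 4 => Le | _ => Lf
  end.

Lemma letter_codeK : cancel letter_code letter_decode.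
Proof. by case; rewrite /letter_decode /= inordK. Qed.

HB.instance Definition _ := Finite.copy letter (can_type letter_codeK).

Definition dirs (x : letter) : {set direction} :=
  match x with
  | La => [set Right; Down]
  | Lb => [set Up; Down]
  | Lc => [set Up; Right]
  | Ld => [set Left; Down]
  | Le => [set Left; Right]
  | Lf => [set Up; Left]
  end.

(* Columns are read from top to bottom, with indices 0, ..., m - 1. *)
Definition alpha_word m (w : m.-tuple letter) : bool :=
  [&& [forall i : 'I_m, (i == 0 :> nat) ==> (Up \notin dirs (tnth w i))],
      [forall i : 'I_m, (i.+1 == m) ==> (Down \notin dirs (tnth w i))]
    & [forall i : 'I_m, forall j : 'I_m, (j == i.+1 :> nat) ==>
        ((Down \in dirs (tnth w i)) == (Up \in dirs (tnth w j)))]].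

Definition arcD m (v w : m.-tuple letter) : bool :=
  [&& alpha_word v, alpha_word w
    & [forall i : 'I_m,
        (Right \in dirs (tnth v i)) == (Left \in dirs (tnth w i))]].

Definition outlet m (w : m.-tuple letter) : m.-tuple bool :=
  [tuple Right \in dirs (tnth w i) | i < m].

Definition vertices m : {set m.-tuple bool} :=
  [set outlet w | w : m.-tuple letter & alpha_word w].

Definition arcDstar m (v w : m.-tuple bool) : bool :=
  [exists x : m.-tuple letter, exists y : m.-tuple letter,
    [&& outlet x == v, outlet y == w & arcD x y]].

Definition underlying m : rel (m.-tuple bool) :=
  [rel v w | arcDstar v w || arcDstar w v].

(* Components are represented by their vertex sets; the digraph structure of
   a component is the restriction of [arcDstar] to it. *)
Definition component m (v : m.-tuple bool) : {set m.-tuple bool} :=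
  [set w in vertices m | connect (@underlying m) v w].

Definition components m : {set {set m.-tuple bool}} :=
  [set component v | v in vertices m].

Definition ones m : m.-tuple bool := [tuple of nseq m true].

Definition Astar m : {set m.-tuple bool} := component (ones m).

(* [B 1], ..., [B m./2] lists each component other than [Astar m] exactly
   once, by nonincreasing size; the other values of [B] are irrelevant. *)
Definition B_listing m (B : nat -> {set m.-tuple bool}) : Prop :=
  perm_eq [seq B s | s <- iota 1 m./2] (enum (components m :\ Astar m)) /\
  (forall s t, 1 <= s -> s <= t -> t <= m./2 -> #|B t| <= #|B s|).

Definition bipartition m (C X Y : {set m.-tuple bool}) : Prop :=
  [/\ X :|: Y = C, [disjoint X & Y],
      {in X &, forall v w, ~~ arcDstar v w}
    & {in Y &, forall v w, ~~ arcDstar v w}].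

Definition bipartite m (C : {set m.-tuple bool}) : Prop :=
  exists X Y, bipartition C X Y.

Definition same_class m (X Y : {set m.-tuple bool}) (v w : m.-tuple bool) :
    Prop :=
  (v \in X /\ w \in X) \/ (v \in Y /\ w \in Y).

Definition reversed m (v : m.-tuple bool) : m.-tuple bool := [tuple of rev v].

(* Main.v *)
(* For an outlet word v let u_i = v_i (+) odd i.  There is an arc v -> w exactly
   when u contains 1010... (of some length congruent to m modulo 2) as a
   subsequence and w is obtained by flipping v outside it; hence the numbers of
   ones in the twisted words of v and w add up to h.*2, where h = uphalf m, and
   | #|u| - h | is constant on components.  Conversely, two successive arcs
   whose subsequences have length at most 2 exchange a one and a zero of u, so
   words with the same number of ones are connected.  The components are thus
   the levels | #|u| - h | = s for s <= m./2, level 0 being that of 1^m, which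
   carries a loop, while for s > 0 the sign of #|u| - h is a 2-colouring.
   Reversal preserves #|u| for m odd and complements it for m even. *)
Require Import Defs.
From mathcomp Require Import all_boot zify.

Set Implicit Arguments.
Unset Strict Implicit.
Unset Printing Implicit Defensive.

(** * Arcs described by the vertical edges of a single column *)

Lemma direction_eqE (x y : direction) :
  (x == y) = match x, y with
             | Up, Up | Down, Down | Left, Left | Right, Right => true
             | _, _ => false
             end.
Proof. by apply/eqP/idP => [<-|]; case: x => //; case: y. Qed.

(** The down bit is implied, as a letter uses two directions; the result is meaningful only for bits
    that extend to a total of 2. *)
Definition letter_of (l r u : bool) : letter :=
  match l, r, u with
  | true, true, _ => Le
  | true, false, true => Lf
  | true, false, false => Ld
  | false, true, true => Lc
  | false, true, false => La
  | false, false, _ => Lb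
  end.

Lemma dirs_count (x : letter) :
  (Left \in dirs x) + (Right \in dirs x) + (Up \in dirs x) + (Down \in dirs x)
  = 2.
Proof. by case: x; rewrite !inE !direction_eqE. Qed.

Lemma dirs_letter_of (l r u d : bool) : l + r + u + d = 2 ->
  [/\ (Left \in dirs (letter_of l r u)) = l,
      (Right \in dirs (letter_of l r u)) = r,
      (Up \in dirs (letter_of l r u)) = u &
      (Down \in dirs (letter_of l r u)) = d].
Proof. by case: l; case: r; case: u; case: d => // _; rewrite !inE !direction_eqE. Qed.

(* [x n] tells whether the vertical edge just above row [n] is used. *)
Definition column m (v w : m.-tuple bool) : Prop :=
  exists x : nat -> bool,
    [/\ x 0 = false, x m = false
      & forall i : 'I_m, tnth v i + tnth w i + x i + x i.+1 = 2].

Lemma column_sym m (v w : m.-tuple bool) : column v w -> column w v.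
Proof.
by case=> x [x0 xm xP]; exists x; split=> // i; rewrite -(xP i) (addnC (tnth w i)).
Qed.

(** Row [i] takes left from [v], right from [w] and up from [x i]; consecutive rows match because
    both read the same [x i.+1]. *)
Lemma column_alpha_word m (v w : m.-tuple bool) : column v w ->
  exists2 y : m.-tuple letter, alpha_word y &
    outlet y = w /\ forall i, (Left \in dirs (tnth y i)) = tnth v i.
Proof.
case=> x [x0 xm xP].
exists [tuple letter_of (tnth v i) (tnth w i) (x i) | i < m].
  apply/and3P; split; apply/forallP=> i; last apply/forallP=> j;
    apply/implyP=> /eqP ij; rewrite !tnth_mktuple.
  - by have [_ _ -> _] := dirs_letter_of (xP i); rewrite ij x0.
  - by have [_ _ _ ->] := dirs_letter_of (xP i); rewrite ij xm.
  - have [_ _ _ ->] := dirs_letter_of (xP i).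
    by have [_ _ -> _] := dirs_letter_of (xP j); rewrite ij.
split=> [|i]; last by rewrite tnth_mktuple; case: (dirs_letter_of (xP i)).
by apply: eq_from_tnth => i; rewrite !tnth_mktuple; case: (dirs_letter_of (xP i)).
Qed.

Lemma alpha_word_column m (y : m.-tuple letter) : alpha_word y ->
  column [tuple Left \in dirs (tnth y i) | i < m] (outlet y).
Proof.
case/and3P=> /forallP up0 /forallP downm /forallP vert.
(* The edge above a row is the down edge of the previous row, hence the shift; the default [La] is
   never read for [n <= m]. *)
exists (fun n => if n is n'.+1 then Down \in dirs (nth La y n') else false).
split=> // [|i].
  case: m y up0 downm vert => // m y _ /(_ ord_max) + _.
  by rewrite eqxx (tnth_nth La) => /negPf.
rewrite !tnth_mktuple -(dirs_count (tnth y i)) -(tnth_nth La).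
congr (_ + _ + nat_of_bool _ + _).
case: i => [[|i] lt_i] /=.
  by have := up0 (Ordinal lt_i); rewrite eqxx => /negPf ->.
have /forallP/(_ (Ordinal lt_i)) := vert (Ordinal (ltnW lt_i)).
by rewrite eqxx => /eqP <-; rewrite (tnth_nth La).
Qed.

(** The second column of an arc already carries both words, on its two sides. The first matters only
    through its outlets, and exchanging the sides of the second provides one. *)
Lemma arcDstarP m (v w : m.-tuple bool) : reflect (column v w) (arcDstar v w).
Proof.
apply: (iffP existsP) => [[x /existsP[y]] | cvw].
  case/and3P=> /eqP <- /eqP <- /and3P[_ wy /forallP lr].
  rewrite (_ : outlet x = [tuple Left \in dirs (tnth y i) | i < m]).
    exact: alpha_word_column.
  by apply: eq_from_tnth => i; rewrite !tnth_mktuple; apply/eqP.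
have [x wx [xv _]] := column_alpha_word (column_sym cvw).
have [y wy [yw yv]] := column_alpha_word cvw.
exists x; apply/existsP; exists y; rewrite xv yw !eqxx /arcD wx wy /=.
by apply/forallP => i; rewrite yv -xv tnth_mktuple.
Qed.

Lemma arcDstar_sym m (v w : m.-tuple bool) : arcDstar v w = arcDstar w v.
Proof. by apply/arcDstarP/arcDstarP; apply: column_sym. Qed.

Lemma underlyingE m : @underlying m =2 @arcDstar m.
Proof. by move=> v w; rewrite /underlying /= (arcDstar_sym w) orbb. Qed.

Lemma arcDstar_vertex m (v w : m.-tuple bool) : arcDstar v w -> v \in vertices m.
Proof.
case/existsP=> x /existsP[y /and3P[/eqP <- _ /and3P[wx _ _]]].
by apply/imsetP; exists x; rewrite ?inE.
Qed.

Lemma vertex_arcDstar m (v : m.-tuple bool) :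
  v \in vertices m -> exists w, arcDstar v w.
Proof.
case/imsetP=> y wy ->; exists [tuple Left \in dirs (tnth y i) | i < m].
by apply/arcDstarP/column_sym/alpha_word_column; rewrite inE in wy.
Qed.

Lemma underlying_sym m : connect_sym (@underlying m).
Proof. by apply: sym_connect_sym => v w; rewrite !underlyingE arcDstar_sym. Qed.

(** * Twisted words and their weight *)

Definition twist m (v : m.-tuple bool) : {set 'I_m} :=
  [set i : 'I_m | tnth v i (+) odd i].

Definition untwist m (A : {set 'I_m}) : m.-tuple bool :=
  [tuple (i \in A) (+) odd i | i < m].

Lemma twistK m : cancel (@twist m) (@untwist m).
Proof. by move=> v; apply: eq_from_tnth => i; rewrite tnth_mktuple inE addbK. Qed.

Lemma untwistK m : cancel (@untwist m) (@twist m).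
Proof. by move=> A; apply/setP => i; rewrite inE tnth_mktuple addbK. Qed.

Definition weight m (v : m.-tuple bool) := #|twist v|.

Lemma weightE m (v : m.-tuple bool) :
  weight v = \sum_(i < m) (tnth v i (+) odd i).
Proof.
rewrite /weight -sum1_card big_mkcond; apply: eq_bigr => i _; rewrite inE.
by case: (_ (+) _).
Qed.

Lemma weight_le m (v : m.-tuple bool) : weight v <= m.
Proof. by rewrite -[leqRHS](card_ord m) max_card. Qed.

Lemma card_weight m k : #|[set v : m.-tuple bool | weight v == k]| = 'C(m, k).
Proof.
rewrite -[in RHS](card_ord m) -card_draws -(card_imset _ (can_inj (@untwistK m))).
apply: eq_card => v; rewrite inE; apply/idP/imsetP => [wv|[A]].
  by exists (twist v); rewrite ?inE ?twistK.
by rewrite inE => Ak ->; rewrite /weight untwistK.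
Qed.

Lemma addn_odd m : m + odd m = (uphalf m).*2.
Proof. by lia. Qed.

(** With [z n = odd n (+) x n], the column equation says that the two twisted bits of row [i] add up
    to [1 + z i.+1 - z i], so the sum telescopes. *)
Lemma arcDstar_weight m (v w : m.-tuple bool) :
  arcDstar v w -> weight v + weight w = (uphalf m).*2.
Proof.
case/arcDstarP=> x [x0 xm xP]; rewrite !weightE -addn_odd.
have sumE n : n <= m ->
    \sum_(i < n) (nth false v i (+) odd i) + \sum_(i < n) (nth false w i (+) odd i)
    = n + (odd n (+) x n).
  elim: n => [|n IHn] lt_n; first by rewrite !big_ord0 x0.
  have := xP (Ordinal lt_n); rewrite !(tnth_nth false) !big_ord_recr /=.
  move: (IHn (ltnW lt_n)).
  set p := \sum_(i < n) _; set q := \sum_(i < n) _ => pq.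
  rewrite addnACA {}pq.
  by case: (nth _ v n); case: (nth _ w n); case: (x n); case: (x n.+1);
    case: (odd n) => // _; rewrite ?addn0 ?addn1 ?addn2.
have := sumE m (leqnn m); rewrite xm addbF => <-.
by congr (_ + _); apply: eq_bigr => i _; rewrite (tnth_nth false).
Qed.

(** * Connectivity of words of equal weight *)

(** The sequence [odd n (+) x n] encodes an arc: a twisted bit is flipped where it is constant, a
    one is kept where it rises, a zero where it falls. Here it is constantly false. *)
Lemma arcDstar_compl m (A : {set 'I_m}) : ~~ odd m ->
  arcDstar (untwist A) (untwist (~: A)).
Proof.
move=> em; apply/arcDstarP; exists odd; split=> // [|i]; first exact/negbTE.
by rewrite !tnth_mktuple !inE /=; case: (i \in A); case: (odd i).
Qed.

Lemma arcDstar_keep1 m (A : {set 'I_m}) (i : 'I_m) : odd m -> i \in A ->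
  arcDstar (untwist A) (untwist (i |: ~: A)).
Proof.
(* A single rise, across row [i]. *)
move=> om iA; apply/arcDstarP; exists (fun n => odd n (+) (i < n)).
split=> // [|k]; first by rewrite om ltn_ord.
rewrite !tnth_mktuple !inE /= -val_eqE ltnS /=.
have [ki|ik|/val_inj->] := ltngtP (k : nat) i; last first.
- by rewrite iA; case: (odd i).
- by case: (k \in A); case: (odd k).
- by case: (k \in A); case: (odd k).
Qed.

Lemma arcDstar_keep2 m (A : {set 'I_m}) (i j : 'I_m) :
  ~~ odd m -> i < j -> i \in A -> j \notin A ->
  arcDstar (untwist A) (untwist ((i |: ~: A) :\ j)).
Proof.
move=> em ij iA jA; apply/arcDstarP.
(* A rise across row [i], then a fall across row [j]. *)
exists (fun n => odd n (+) (i < n) (+) (j < n)).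
split=> // [|k]; first by rewrite (negbTE em) !ltn_ord.
rewrite !tnth_mktuple !inE /= -!val_eqE !ltnS /=.
have [kj|jk|/val_inj->] := ltngtP (k : nat) j.
- have [ki|ik|/val_inj->] := ltngtP (k : nat) i; last by rewrite iA; case: (odd i).
    by case: (k \in A); case: (odd k).
  by case: (k \in A); case: (odd k).
- rewrite (ltn_trans ij jk) (ltnW (ltn_trans ij jk)) gtn_eqF ?(ltn_trans ij jk) //.
  by case: (k \in A); case: (odd k).
- by rewrite (negbTE jA) ij (ltnW ij); case: (odd j).
Qed.

Lemma connect_arcDstar m (v w : m.-tuple bool) :
  arcDstar v w -> connect (@underlying m) v w.
Proof. by move=> vw; apply: connect1; rewrite underlyingE. Qed.

(** Two arcs flip every row twice, except [i] and [j], which are each kept once: one per arc for [m]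
    odd, both by the same arc for [m] even. *)
Lemma connect_swap m (A : {set 'I_m}) (i j : 'I_m) : i \in A -> j \notin A ->
  connect (@underlying m) (untwist A) (untwist (j |: A :\ i)).
Proof.
move=> iA jA; have [om|em] := boolP (odd m).
  apply: connect_trans (connect_arcDstar (arcDstar_keep1 om iA)) _.
  have jW : j \in i |: ~: A by rewrite !inE jA orbT.
  rewrite (_ : j |: A :\ i = j |: ~: (i |: ~: A)).
    exact/connect_arcDstar/arcDstar_keep1.
  by apply/setP => k; rewrite !inE negb_or negbK.
(* A kept pair must read one before zero; when [j < i] this holds in the complement of [A], so the
   full flip comes first. *)
have [ji|ij|/val_inj ij] := ltngtP (j : nat) i; last by rewrite ij iA in jA.
  apply: connect_trans (connect_arcDstar (arcDstar_compl A em)) _.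
  rewrite (_ : j |: A :\ i = (j |: ~: ~: A) :\ i).
    by apply/connect_arcDstar/arcDstar_keep2; rewrite ?inE ?negbK.
  apply/setP => k; rewrite !inE negbK; case: (k =P j) => [->|//].
  by rewrite /= -val_eqE ltn_eqF.
apply: connect_trans (connect_arcDstar (arcDstar_keep2 em ij iA jA)) _.
rewrite (_ : j |: A :\ i = ~: ((i |: ~: A) :\ j)).
  exact/connect_arcDstar/arcDstar_compl.
by apply/setP => k; rewrite !inE negb_and negb_or !negbK.
Qed.

(** Each exchange between [A :\: B] and [B :\: A] shrinks the former by one. *)
Lemma connect_card_eq m (A B : {set 'I_m}) : #|A| = #|B| ->
  connect (@underlying m) (untwist A) (untwist B).
Proof.
have [n] := ubnP #|A :\: B|; elim: n A => // n IHn A lt_n eqAB.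
have [AB0|[i]] := set_0Vmem (A :\: B).
  suff -> : A = B by exact: connect0.
  by apply/eqP; rewrite eqEcard eqAB leqnn andbT -setD_eq0 AB0.
rewrite inE => /andP[iB iA].
have [BA0|[j]] := set_0Vmem (B :\: A).
  have /eqP : B = A by apply/eqP; rewrite eqEcard eqAB leqnn andbT -setD_eq0 BA0.
  by move/eqP=> BA; rewrite BA iA in iB.
rewrite inE => /andP[jA jB].
apply: connect_trans (connect_swap iA jA) (IHn _ _ _).
  have -> : (j |: A :\ i) :\: B = (A :\: B) :\ i.
    apply/setP => k; rewrite !inE; case: (k =P j) => [->|_] /=.
      by rewrite jB andbF.
    by rewrite andbCA.
  by move: lt_n; rewrite (cardsD1 i (A :\: B)) inE iA iB.
rewrite cardsU1 !inE (negbTE jA) andbF /= -eqAB.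
by rewrite (cardsD1 i A) iA.
Qed.

Lemma connect_weight_eq m (v w : m.-tuple bool) : weight v = weight w ->
  connect (@underlying m) v w.
Proof. by move/connect_card_eq; rewrite !twistK. Qed.

(** * Vertices, and components as levels *)

(** The bound amounts to [odd m <= weight v]: it excludes only the empty twisted word for [m] odd,
    and holds because a neighbour has weight at most [m]. *)
Lemma verticesE m (v : m.-tuple bool) :
  (v \in vertices m) = ((uphalf m).*2 <= m + weight v).
Proof.
apply/idP/idP => [/vertex_arcDstar[w /arcDstar_weight <-]|].
  by rewrite addnC leq_add2r weight_le.
rewrite -addn_odd leq_add2l -(twistK v) /weight untwistK.
have [om /card_gt0P[i iA]|em _] := boolP (odd m).
  exact: arcDstar_vertex (arcDstar_keep1 om iA).
exact: arcDstar_vertex (arcDstar_compl _ em).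
Qed.

Definition level m s : {set m.-tuple bool} :=
  [set v | (weight v == uphalf m + s) || (weight v + s == uphalf m)].

Lemma level_vertices m s : s <= m./2 -> level m s \subset vertices m.
Proof.
move=> sm; apply/subsetP => v; rewrite inE verticesE; lia.
Qed.

Lemma vertex_level m (v : m.-tuple bool) : v \in vertices m ->
  exists2 s, s <= m./2 & v \in level m s.
Proof.
rewrite verticesE => vm; have le_v := weight_le v.
have [hv|vh] := leqP (uphalf m) (weight v).
  by exists (weight v - uphalf m); rewrite ?inE; lia.
by exists (uphalf m - weight v); rewrite ?inE; lia.
Qed.

(** Arcs reflect the weight about [uphalf m], so a level is closed under them. *)
Lemma component_level m s (v : m.-tuple bool) : s <= m./2 -> v \in level m s ->
  component v = level m s.
Proof.
move=> sm vs; apply/setP => w; rewrite inE.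
have vV := subsetP (level_vertices sm) _ vs.
apply/andP/idP => [[_ vw]|ws].
  have clos : closed (@underlying m) (level m s).
    apply: intro_closed (@underlying_sym m) _ _ => x y.
    by rewrite underlyingE => /arcDstar_weight; rewrite !inE; lia.
  by rewrite -(closed_connect clos vw).
split; first exact: subsetP (level_vertices sm) _ ws.
have [vw|vw] := eqVneq (weight v) (weight w); first exact: connect_weight_eq.
(* The two weights are now mirror images, and any arc out of [v] reaches the weight of [w]. *)
have [u vu] := vertex_arcDstar vV.
apply: connect_trans (connect_arcDstar vu) (connect_weight_eq _).
by have := arcDstar_weight vu; move: vs ws; rewrite !inE; lia.
Qed.

(** * Counting the levels; the level of the word of ones *)

Lemma card_level0 m : #|level m 0| = 'C(m, uphalf m).
Proof.
by rewrite -card_weight; apply: eq_card => v; rewrite !inE !addn0 orbb.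
Qed.

Lemma card_level m s : 0 < s <= m./2 ->
  #|level m s| = 'C(m, uphalf m + s) + 'C(m, uphalf m - s).
Proof.
move=> sm; rewrite -!card_weight -cardsUI -[LHS]addn0.
congr (_ + _); first by apply: eq_card => v; rewrite !inE; lia.
by apply/esym/eqP; rewrite cards_eq0; apply/eqP/setP => v; rewrite !inE; lia.
Qed.

Lemma level_neq0 m s : s <= m./2 -> level m s != set0.
Proof.
move=> sm; have : 0 < 'C(m, uphalf m + s) by rewrite bin_gt0; lia.
rewrite -card_weight card_gt0 => /set0Pn[v].
by rewrite inE => vs; apply/set0Pn; exists v; rewrite inE vs.
Qed.

(** Levels of different index are disjoint, and none in this range is empty. *)
Lemma level_inj m : {in [pred s | s <= m./2] &, injective (level m)}.
Proof.
move=> s t; rewrite !inE => /level_neq0/set0Pn[v vs] _ st.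
by move: vs (vs); rewrite {1}st !inE; lia.
Qed.

Lemma componentsE m : components m = [set level m s | s : 'I_(m./2).+1].
Proof.
apply/setP => C; apply/imsetP/imsetP => [[v /vertex_level[s sm vs] ->]|[s _ ->]].
  by exists (inord s); rewrite ?inordK // (component_level sm).
have sm : s <= m./2 by rewrite -ltnS.
have /set0Pn[v vs] := level_neq0 sm; exists v; last by rewrite (component_level sm).
exact: subsetP (level_vertices sm) _ vs.
Qed.

Lemma card_components m : #|components m| = m./2 + 1.
Proof.
rewrite componentsE card_in_imset ?card_ord ?addn1 // => s t _ _ /level_inj st.
by apply/val_inj/st; rewrite inE -ltnS.
Qed.

(** The twisted word marks the rows of even index, [uphalf m] in number. *)
Lemma ones_level0 m : ones m \in level m 0.
Proof.
rewrite inE weightE addn0 [X in X == _](_ : _ = uphalf m) ?eqxx //.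
rewrite (eq_bigr (fun i : 'I_m => ~~ odd i : nat)) => [|i _]; last first.
  by rewrite (tnth_nth false) /= nth_nseq ltn_ord.
elim: m => [|m IHm]; first by rewrite big_ord0.
by rewrite big_ord_recr /= IHm; lia.
Qed.

Lemma arcDstar_ones m : arcDstar (ones m) (ones m).
Proof.
(* No vertical edge is used: every letter is [Le]. *)
apply/arcDstarP; exists xpred0; split=> // i.
by rewrite (tnth_nth false) /= nth_nseq ltn_ord.
Qed.

Lemma AstarE m : Astar m = level m 0.
Proof. exact: component_level (ones_level0 m). Qed.

(** * Two-colouring and sizes of the levels *)

(** Reflection about [uphalf m] exchanges the two weights, which differ as [s > 0]. *)
Lemma level_bipartition m s : 0 < s ->
  bipartition (level m s) [set v | weight v == uphalf m + s]
                          [set v | weight v + s == uphalf m].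
Proof.
move=> s_gt0; split.
- by apply/setP => v; rewrite !inE.
- by rewrite disjoint_subset; apply/subsetP => v; rewrite !inE; lia.
- by move=> v w; rewrite !inE => vs ws; apply/negP=> /arcDstar_weight; lia.
- by move=> v w; rewrite !inE => vs ws; apply/negP=> /arcDstar_weight; lia.
Qed.

(** By symmetry the upper binomial becomes the left neighbour of the lower one, and Pascal's rule
    adds them. *)
Lemma card_level_odd m s : odd m -> 0 < s <= m./2 ->
  #|level m s| = 'C(m + 1, (m + 1)./2 - s).
Proof.
move=> om sm; rewrite card_level //.
have -> : m + 1 = m.+1 by lia.
have -> : m.+1./2 - s = (uphalf m - s).-1.+1 by lia.
rewrite binS -(bin_sub (m := uphalf m + s)); last by lia.
by rewrite addnC; congr ('C(_, _) + 'C(_, _)); lia.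
Qed.

Lemma card_level_even m s : ~~ odd m -> 0 < s <= m./2 ->
  #|level m s| = 2 * 'C(m, m./2 - s).
Proof.
move=> em sm; rewrite card_level // -(bin_sub (m := uphalf m + s)); last by lia.
by rewrite mul2n -addnn; congr ('C(_, _) + 'C(_, _)); lia.
Qed.

(** The ratio of the two binomials is that of [k.+1] to [n - k], and [k.+1 <= n - k]. *)
Lemma leq_binS n k : k.*2 < n -> 'C(n, k) <= 'C(n, k.+1).
Proof.
move=> kn; have kn0 : 0 < n - k by lia.
by rewrite -(leq_pmul2l kn0) -mul_bin_left leq_mul2r; apply/orP; right; lia.
Qed.

Lemma card_level_anti m s t : 0 < s -> s <= t -> t <= m./2 ->
  #|level m t| <= #|level m s|.
Proof.
move=> s0; elim: t => [|t IHt] st tm; first lia.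
have [<-//|neq_st] := eqVneq s t.+1; apply: leq_trans (IHt _ _); try lia.
have [om|em] := boolP (odd m).
  rewrite !card_level_odd //; try lia.
  have -> : (m + 1)./2 - t = ((m + 1)./2 - t.+1).+1 by lia.
  by apply: leq_binS; lia.
rewrite !card_level_even //; try lia.
have -> : m./2 - t = (m./2 - t.+1).+1 by lia.
by rewrite leq_mul2l; apply: leq_binS; lia.
Qed.

(** * Listings of the components by size *)

Lemma B_listing_level m : B_listing (level m).
Proof.
split=> [|s t s0 st tm]; last exact: card_level_anti.
apply: uniq_perm; rewrite ?enum_uniq //.
  rewrite map_inj_in_uniq ?iota_uniq // => s t; rewrite !mem_iota => sm tm.
  by apply: level_inj; rewrite inE; lia.
move=> C; rewrite mem_enum inE inE AstarE componentsE.
apply/mapP/andP => [[s + ->]|[C0 /imsetP[s _ Cs]]].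
  rewrite mem_iota => sm; split.
    by apply/eqP => /level_inj; rewrite !inE => st; have := st _ _; lia.
  by apply/imsetP; exists (inord s); rewrite ?inordK //; lia.
exists (s : nat); rewrite // mem_iota; move: C0; rewrite Cs => s0.
have : (s : nat) != 0 by apply: contra_neq s0 => ->.
by have := ltn_ord s; lia.
Qed.

(** Both listings have nonincreasing sizes and are permutations of each other, so their size
    sequences coincide, without identifying [B s] with [level m s]. *)
Lemma B_listing_components m (B : nat -> {set m.-tuple bool}) :
  B_listing B -> forall s, 0 < s <= m./2 ->
  #|B s| = #|level m s| /\ exists2 t, 0 < t <= m./2 & B s = level m t.
Proof.
move=> [permB ltB] s sm; have [permL ltL] := B_listing_level m.
have permBL : perm_eq [seq B i | i <- iota 1 m./2] [seq level m i | i <- iota 1 m./2].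
  by rewrite (perm_trans permB) // perm_sym.
have s_iota : s \in iota 1 m./2 by rewrite mem_iota; lia.
split; last first.
  have : B s \in [seq level m i | i <- iota 1 m./2].
    by rewrite -(perm_mem permBL) map_f.
  by case/mapP=> t; rewrite mem_iota => tm ->; exists t => //; lia.
have sorted_card (F : nat -> {set m.-tuple bool}) :
    (forall i j, 1 <= i -> i <= j -> j <= m./2 -> #|F j| <= #|F i|) ->
    sorted geq [seq #|F i| | i <- iota 1 m./2].
  move=> ltF; rewrite sorted_map.
  apply: (sub_in_sorted (P := mem (iota 1 m./2)) (e := leq)); last exact: iota_sorted.
    by move=> i j; rewrite !mem_iota => im jm ij; apply: ltF; lia.
  by apply/allP.
have geq_trans : transitive geq by move=> x y z /= xy xz; apply: leq_trans xz xy.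
have geq_anti : antisymmetric geq by move=> x y; rewrite andbC => /anti_leq.
have := perm_map (fun A : {set m.-tuple bool} => #|A|) permBL.
rewrite -!map_comp => /(sorted_eq geq_trans geq_anti (sorted_card B ltB)).
by move/(_ (sorted_card _ ltL))/eq_in_map; apply.
Qed.

(** * Reversal and the classes of a bipartition *)

(** Row [i] goes to row [m - 1 - i], of the same parity exactly when [m] is odd; for [m] even the
    twisted bits are also complemented. *)
Lemma weight_reversed m (v : m.-tuple bool) :
  weight (reversed v) = if odd m then weight v else m - weight v.
Proof.
have tnth_rev i : tnth (reversed v) i = tnth v (rev_ord i).
  by rewrite !(tnth_nth false) /= nth_rev size_tuple.
rewrite /weight -(card_preimset (twist v) (can_inj (@rev_ordK m))).
case: ifP => om.
  by apply: eq_card => i; rewrite !inE tnth_rev /=; congr (_ (+) _); have := ltn_ord i; lia.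
transitivity #|~: (@rev_ord m @^-1: twist v)|; last by rewrite cardsCs setCK card_ord.
apply: eq_card => i; rewrite !inE tnth_rev -addbN /=.
by congr (_ (+) _); have := ltn_ord i; lia.
Qed.

Lemma Astar_not_bipartite m : ~ bipartite (level m 0).
Proof.
case=> X [Y [XY _ noX noY]]; have := ones_level0 m.
rewrite -XY inE => /orP[o|o]; [have := noX _ _ o o | have := noY _ _ o o];
  by rewrite arcDstar_ones.
Qed.

(** Both the class and the weight switch along every arc, so the equivalence of agreeing with [v] in
    class and in weight, the predicate [P], spreads over the component. *)
Lemma bipartition_weight m s (v w : m.-tuple bool) (X Y : {set m.-tuple bool}) :
  s <= m./2 -> bipartition (level m s) X Y -> v \in level m s -> w \in level m s ->
  same_class X Y v w <-> weight v = weight w.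
Proof.
(* Level 0 is ruled out by the loop at the word of ones. *)
move=> sm bip vs ws; have s0 : 0 < s.
  by case: s sm bip {vs ws} => // sm bip; case: (@Astar_not_bipartite m); exists X, Y.
have [XY dXY noX noY] := bip.
have inY x : x \in level m s -> (x \in Y) = (x \notin X).
  rewrite -XY inE; case: (boolP (x \in X)) => //= xX _.
  by apply/negP => xY; have /pred0P/(_ x) := dXY; rewrite /= xX xY.
pose P := [pred x | (x \in level m s)
                    && (((x \in X) == (v \in X)) == (weight v == weight x))].
have clos : closed (@underlying m) P.
  apply: intro_closed (@underlying_sym m) _ _ => x y.
  rewrite underlyingE => xy /andP[xs xP].
  have wxy := arcDstar_weight xy.
  have ys : y \in level m s by move: xs; rewrite !inE; lia.
  have yX : (y \in X) = (x \notin X).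
    have := noX x y; have := noY x y; rewrite !inY // xy.
    by case: (x \in X); case: (y \in X) => // inYY inXX; [have := inXX isT isT | have := inYY isT isT].
  apply/andP; split=> //; rewrite yX; move: xP vs xs ys; rewrite !inE.
  by case: (x \in X); case: (v \in X); lia.
have : v \in P by rewrite inE vs !eqxx.
have vw : connect (@underlying m) v w.
  by have := ws; rewrite -(component_level sm vs) inE => /andP[].
rewrite (closed_connect clos vw) inE ws /= => /eqP wP.
rewrite /same_class !inY //; split=> [sc|/eqP].
  by apply/eqP; rewrite -wP; move: sc; case: (v \in X); case: (w \in X) => -[] [].
by rewrite -wP; case: (v \in X); case: (w \in X) => // _; [left | right].
Qed.

Theorem theorem1 (m : nat) (hm : 2 <= m) :
  [/\ #|components m| = m./2 + 1,
      Astar m \in components m /\ ones m \in Astar m,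
      (exists B : nat -> {set m.-tuple bool}, B_listing B),
      (forall B : nat -> {set m.-tuple bool}, B_listing B ->
        [/\ vertices m = Astar m :|: \bigcup_(1 <= s < m./2.+1) B s,
            (forall s, 1 <= s <= m./2 -> bipartite (B s)),
            (odd m ->
               (forall s, 1 <= s <= m./2 ->
                  #|B s| = 'C(m + 1, (m + 1)./2 - s)) /\
               #|Astar m| = 'C(m, (m - 1)./2))
          & (~~ odd m ->
               (forall s, 1 <= s <= m./2 -> #|B s| = 2 * 'C(m, m./2 - s)) /\
               #|Astar m| = 'C(m, m./2))])
    & (forall v : m.-tuple bool, v \in vertices m ->
         reversed v \in component v /\
         (forall X Y : {set m.-tuple bool}, bipartition (component v) X Y ->
            (same_class X Y v (reversed v) <-> odd m)))].
Proof.
split.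
- exact: card_components.
- rewrite AstarE ones_level0 componentsE; split=> //.
  by apply/imsetP; exists ord0.
- by exists (level m); apply: B_listing_level.
- move=> B listB; have BP := B_listing_components listB; split.
  + apply/setP => v; rewrite AstarE in_setU; apply/idP/orP.
      case/vertex_level=> s sm vs.
      have [s0|s0] := posnP s; [by left; rewrite -s0 | right].
      (* The level occurs in any listing, at some position [t], whose term is then isolated in the
         union. *)
      have : level m s \in [seq B i | i <- iota 1 m./2].
        have [permB _] := listB; have [permL _] := B_listing_level m.
        by rewrite (perm_mem permB) -(perm_mem permL) map_f // mem_iota; lia.
      case/mapP=> t; rewrite mem_iota => tm st.
      rewrite (big_cat_nat (n := t)) /=; try lia.
      by rewrite (@big_ltn _ _ _ t) ?inE -?st ?vs ?orbT //; lia.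
    case=> [v0|]; first exact: subsetP (level_vertices _) _ v0.
    rewrite big_seq; elim/big_ind: _ => [|C D IHC IHD|s]; rewrite ?inE //.
      by case/orP.
    rewrite mem_index_iota => sm vs.
    by have [_ [t tm Bt]] := BP s sm; rewrite Bt in vs; apply: subsetP (level_vertices _) _ vs; lia.
  + move=> s /BP[_ [t /andP[t0 _] ->]].
    by eexists; eexists; apply: level_bipartition.
  + move=> om; split=> [s sm|]; first by rewrite (BP s sm).1 card_level_odd.
    rewrite AstarE card_level0 -bin_sub; last by lia.
    by congr ('C(_, _)); lia.
  + move=> em; split=> [s sm|]; first by rewrite (BP s sm).1 card_level_even.
    by rewrite AstarE card_level0; congr ('C(_, _)); lia.
- move=> v /vertex_level[s sm vs]; rewrite (component_level sm vs).
  have rs : reversed v \in level m s.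
    by move: vs; rewrite !inE weight_reversed; case: ifP; lia.
  split=> // X Y bip; rewrite (bipartition_weight sm bip vs rs) weight_reversed.
  (* For [m] even, equal weights would both be [m./2], forcing [s = 0], a level that is not
     bipartite. *)
  case: ifP => om; split=> // wv; exfalso.
  apply: (@Astar_not_bipartite m); exists X, Y.
  suff s0 : s = 0 by rewrite -s0.
  by move: vs (weight_le v); rewrite inE; lia.
Qed.
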